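(* Assume $\alpha\neq1$ and $\mu\neq0$. Fix $k\ge1$, let $w_j=1$ and $t_j=j$ for $j=1,\dots,k$ (and $t_0=0$), and choose $a_j=\exp(\mu_j)$ for $j=1,\dots,k-1$, where $\mu_j$ is the location parameter of $\log Z_j^*$ (determined by $a_{j+1},\dots,a_{k-1}$ through the backward recursion). Then $Z_0^*\le P^*$ almost surely and $\log Z_0^*\sim\mathcal S(\alpha,-\beta,\sigma_0,\mu_0)$ with $$\mu_0=-\mu+\log\frac{e^{-\mu k}-1}{e^{-\mu}-1},\qquad \sigma_0^\alpha=\sigma^\alpha\left(1+\sum_{j=1}^{k-1}\left(1-\frac{e^{-\mu j}-1}{e^{-\mu k}-1}\right)^\alpha\right).$$
   Context: Stable laws: for $\alpha^*\in(0,2]$, $\beta^*\in[-1,1]$, $\sigma^*>0$, $\mu^*\in\mathbb R$, write $Z\sim\mathcal S(\alpha^*,\beta^*,\sigma^*,\mu^* )$ if the real random variable $Z$ has characteristic function $\mathbb E e^{i\theta Z}=\exp\{i\theta\mu^*-|\sigma^*\theta|^{\alpha^*}(1-i\beta^*\operatorname{sgn}(\theta)\tan\frac{\pi\alpha^*}{2})\}$ when $\alpha^*\neq1$, and $\mathbb E e^{i\theta Z}=\exp\{i\theta\mu^*-|\sigma^*\theta|(1+i\beta^*\frac{2}{\pi}\operatorname{sgn}(\theta)\log|\theta|)\}$ when $\alpha^*=1$. Wealth process: on a probability space $(\Omega,\mathcal F,\mathbb P)$, $X:[0,\infty)\times\Omega\to(0,\infty)$ is a process such that $\log X$ is a Lévy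 process (càdlàg paths, independent increments) with, for all $0\le s<t$, $\log\frac{X(t)}{X(s)}\sim\mathcal S(\alpha,\beta,\sigma(t-s)^{1/\alpha},\mu(t-s))$, where $\alpha\in(0,2]$, $\beta\in[-1,1]$, $\sigma>0$, $\mu\in\mathbb R$ are fixed. Set $X_j=X(t_j)/X(t_{j-1})$ for $j\ge1$. Required initial investment: for withdrawals $w_1,\dots,w_k>0$ at times $t_1<\dots<t_k$, $W_{k-1}^*=w_kX_k^{-1}$ and $W_{j-1}^*=X_j^{-1}(W_j^*+w_j)$ for $j=k-1,\dots,1$; set $P^*=W_0^*$. Lower bound: for constants $a_1,\dots,a_{k-1}>0$, with $b_j=\frac{a_j}{a_j+w_j}$, set $Z_{k-1}^*=W_{k-1}^*$ and $Z_{j-1}^*=X_j^{-1}(a_j+w_j)\left(\frac{Z_j^*}{a_j}\right)^{b_j}$ for $j=k-1,\dots,1$. *)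

(* Defs.v *)
From HB Require Import structures.
From mathcomp Require Import all_boot all_order all_algebra.
From mathcomp Require Import all_classical all_reals all_analysis.
Set Implicit Arguments. Unset Strict Implicit. Unset Printing Implicit Defensive.
Import Order.TTheory GRing.Theory Num.Theory.
Import numFieldNormedType.Exports.
Local Open Scope classical_set_scope.
Local Open Scope ring_scope.

Section Defs.
Context {R : realType} {d : measure_display} {T : measurableType d}.

(* Z ~ S(al, be, si, mu): characteristic function written out via its real
   and imaginary parts: E cos(th Z) = Re phi(th), E sin(th Z) = Im phi(th),
   with phi(th) = exp(-|si th|^al) * exp(i * arg(th)). *)
Definition stable_arg (al be si mu th : R) : R :=
  if al != 1 then
    th * mu + `|si * th| `^ al * be * Num.sg th * tan (pi * al / 2)
  else
    th * mu - `|si * th| * be * (2 / pi) * Num.sg th * ln `|th|.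

Definition stable_law (P : probability T R) (Z : T -> R)
    (al be si mu : R) : Prop :=
  measurable_fun setT Z /\
  forall th : R,
    (\int[P]_w (cos (th * Z w))%:E =
       (expR (- (`|si * th| `^ al)) * cos (stable_arg al be si mu th))%:E)%E /\
    (\int[P]_w (sin (th * Z w))%:E =
       (expR (- (`|si * th| `^ al)) * sin (stable_arg al be si mu th))%:E)%E.

Definition mutually_independent (P : probability T R) (n : nat)
    (Y : 'I_n -> T -> R) : Prop :=
  (forall i, measurable_fun setT (Y i)) /\
  forall B : 'I_n -> set R, (forall i, measurable (B i)) ->
    P (\bigcap_i (Y i @^-1` B i)) = (\prod_(i < n) P (Y i @^-1` B i))%E.

End Defs.

(* Backward recursions, at a fixed outcome, for increments Xj : nat -> R
   (Xj j = X_j), withdrawals w, and constants a.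
   Waux/Zaux n j computes the quantity with index j, where n = k-1-j. *)
Section Recursions.
Context {R : realType}.
Variables (Xj w : nat -> R) (k : nat).

Fixpoint Waux (n j : nat) : R :=
  match n with
  | 0 => w k / Xj k
  | n'.+1 => (Waux n' j.+1 + w j.+1) / Xj j.+1
  end.

Definition Wstar (j : nat) : R := Waux (k.-1 - j) j.
Definition Pstar : R := Wstar 0.

Variable a : nat -> R.

Fixpoint Zaux (n j : nat) : R :=
  match n with
  | 0 => w k / Xj k
  | n'.+1 => (a j.+1 + w j.+1) / Xj j.+1 *
             (Zaux n' j.+1 / a j.+1) `^ (a j.+1 / (a j.+1 + w j.+1))
  end.

Definition Zstar (j : nat) : R := Zaux (k.-1 - j) j.
End Recursions.

(* Main.v *)
Require Import Defs.
From HB Require Import structures.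
From mathcomp Require Import all_boot all_order all_algebra.
From mathcomp Require Import all_classical all_reals all_analysis.
From mathcomp Require Import measurable_realfun ring.
Import Order.TTheory GRing.Theory Num.Theory.
Import numFieldNormedType.Exports.
Local Open Scope classical_set_scope.
Local Open Scope ring_scope.

(** Weighted AM-GM, [(a + w) (z / a) `^ (a / (a + w)) <= z + w], turns each
step of the recursion for [W*] into the one for [Z*], so [Z_0* <= P*] at every
outcome.  On the logarithmic scale the recursion for [Z*] is affine:
[log Z_{j-1} = b_j log Z_j - log X_j + const] with [b_j = a_j / (a_j + 1)], and
[log Z_j] only involves increments after time [j], hence is independent of
[log X_j].  So stability propagates, the location and scale obeying
[m_{j-1} = b_j m_j - mu + const] and
[s_{j-1}^al = si^al + b_j^al s_j^al].  As the location of a stable law with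
[al != 1] is determined by the law, [a_j = exp m_j], and the constants make
[exp m_{j-1} = q (1 + exp m_j)] with [q = exp (- mu)]: the [exp m_j] are [q]
times geometric sums and the products of the [b_j] telescope. *)

(** Convexity of [expR] between [ln (z / a)] and [0], with weights [s = a / (a + w)] and [1 - s],
    bounds the power by [s * (z / a) + (1 - s)]; multiplied by [a + w] this is [z + w]. *)
Lemma weighted_amgm (R : realType) (a w z : R) : 0 < a -> 0 < w -> 0 < z ->
  (a + w) * (z / a) `^ (a / (a + w)) <= z + w.
Proof.
move=> a0 w0 z0; have aw0 : 0 < a + w by rewrite addr_gt0.
have za0 : 0 < z / a by rewrite divr_gt0.
set s := a / (a + w).
have s0 : 0 <= s by rewrite divr_ge0 ?ltW.
have s1 : s <= 1 by rewrite ler_pdivrMr// mul1r lerDl ltW.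
have := @convex_expR R (Itv01 s0 s1) (ln (z / a)) 0.
rewrite !convRE/= mulr0 addr0 expR0 mulr1 lnK ?posrE// => h.
rewrite /powR gt_eqF// (le_trans (ler_wpM2l (ltW aw0) h))//.
rewrite le_eqVlt; apply/orP; left; apply/eqP.
by rewrite /unstable.onem /s; field; rewrite !gt_eqF.
Qed.

(** * Product measures and independence of two variables *)

Lemma measure_eq_rectangles d1 d2 (T1 : measurableType d1)
    (T2 : measurableType d2) (R : realType)
    (m1 m2 : {measure set (T1 * T2) -> \bar R}) :
  (m1 setT < +oo)%E ->
  (forall A B, measurable A -> measurable B -> m1 (A `*` B) = m2 (A `*` B)) ->
  forall C, measurable C -> m1 C = m2 C.
Proof.
move=> m1oo m12 C mC.
(* Rectangles are stable under intersection and generate the product sigma-algebra; since [m1] is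
   finite, the constant sequence [setT] serves as the exhausting cover. *)
apply: (measure_unique [set A `*` B | A in measurable & B in measurable]
  (fun=> setT)) => //.
- by rewrite measurable_prod_measurableType.
- move=> _ _ [A mA [B mB <-]] [A' mA' [B' mB' <-]].
  by rewrite -setXI; exists (A `&` A'); [exact: measurableI|];
    exists (B `&` B') => //; exact: measurableI.
- by move=> n; exists setT => //; exists setT => //; rewrite setXTT.
- by rewrite bigcup_const//; exists 0%N.
- by move=> _ [A mA [B mB <-]]; exact: m12.
Qed.

Lemma bounded_integrable d (T : measurableType d) (R : realType)
    (P : probability T R) (f : T -> R) (M : R) :
  measurable_fun setT f -> (forall x, `|f x| <= M) ->
  P.-integrable setT (EFin \o f).
Proof.
move=> mf fM; apply: measurable_bounded_integrable => //.
  by rewrite -ge0_fin_numE// fin_num_measure.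
exists M; split; first exact: num_real.
by move=> N MN x _; exact: le_trans (fM x) (ltW MN).
Qed.

Section Independence.
Context {R : realType} {d : measure_display} {T : measurableType d}.
Variable P : probability T R.
Implicit Types (A B : T -> R) (f g : R -> R).

Definition independent2 A B : Prop :=
  forall U V, measurable U -> measurable V ->
    P (A @^-1` U `&` B @^-1` V) = (P (A @^-1` U) * P (B @^-1` V))%E.

(* Both sides are finite measures of [C] that agree on rectangles. *)
Lemma independent2_pair A B (E : set T) (C : set (R * R)) :
  measurable_fun setT A -> measurable_fun setT B -> measurable E ->
  independent2 A B ->
  (forall U V, measurable U -> measurable V ->
     P (A @^-1` U `&` (B @^-1` V `&` E)) =
     (P (A @^-1` U) * (P (B @^-1` V) * P E))%E) ->
  measurable C ->
  P ((fun w => (A w, B w)) @^-1` C `&` E) =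
  (P ((fun w => (A w, B w)) @^-1` C) * P E)%E.
Proof.
move=> mA mB mE AB ABE mC.
have mp : measurable_fun setT (fun w => (A w, B w)).
  exact: measurable_fun_pair.
pose p := MeasurableFun.Pack (MeasurableFun.Class
  (isMeasurableFun.Build _ _ _ _ _ mp)).
have PE0 : 0 <= fine (P E) by rewrite fine_ge0.
have PEE : P E = (fine (P E))%:E by rewrite fineK// fin_num_measure.
rewrite muleC PEE.
apply: (@measure_eq_rectangles _ _ _ _ _ (pushforward (mrestr P mE) p)
  (mscale (NngNum PE0) (pushforward P p))) => //.
- apply: le_lt_trans (ltry 1); apply: (@probability_le1 _ _ _ P).
  by apply: measurableI => //; rewrite preimage_setT.
- move=> U V mU mV.
  change (P (p @^-1` (U `*` V) `&` E) =
    ((fine (P E))%:E * P (p @^-1` (U `*` V)))%E).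
  rewrite -PEE.
  have -> : p @^-1` (U `*` V) = A @^-1` U `&` B @^-1` V.
    by apply/seteqP; split => w /=.
  by rewrite -setIA ABE// AB// muleA muleC.
Qed.

(** The joint law of [A] and [B] agrees with the product of their laws on rectangles, hence
    everywhere, and Fubini then splits the integral. The bound [M] supplies the integrability
    conditions. *)
Lemma expectation_independent2 A B f g (u v M : R) :
  measurable_fun setT A -> measurable_fun setT B -> independent2 A B ->
  measurable_fun setT f -> measurable_fun setT g ->
  (forall x, `|f x| <= M) -> (forall x, `|g x| <= M) ->
  (\int[P]_w (f (A w))%:E = u%:E)%E -> (\int[P]_w (g (B w))%:E = v%:E)%E ->
  (\int[P]_w (f (A w) * g (B w))%:E = (u * v)%:E)%E.
Proof.
move=> mA mB AB mf mg fM gM Ef Eg.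
have mp : measurable_fun setT (fun w => (A w, B w)).
  exact: measurable_fun_pair.
pose p := MeasurableFun.Pack (MeasurableFun.Class
  (isMeasurableFun.Build _ _ _ _ _ mp)).
pose A' := MeasurableFun.Pack (MeasurableFun.Class
  (isMeasurableFun.Build _ _ _ _ _ mA)).
pose B' := MeasurableFun.Pack (MeasurableFun.Class
  (isMeasurableFun.Build _ _ _ _ _ mB)).
pose h (z : R * R) : R := f z.1 * g z.2.
have mh : measurable_fun setT h.
  by apply: measurable_funM; exact: measurableT_comp.
have hM x : `|h x| <= M * M by rewrite normrM ler_pM.
transitivity (\int[distribution P p]_z (h z)%:E)%E.
  rewrite integral_distribution//.
    exact/measurable_EFinP.
  apply: (@bounded_integrable _ _ _ P (fun w => f (A w) * g (B w)) (M * M)).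
    by apply: measurable_funM; exact: measurableT_comp.
  by move=> w; exact: (hM (A w, B w)).
transitivity (\int[distribution P A' \x distribution P B']_z (h z)%:E)%E.
  apply: eq_measure_integral => C mC _; apply/esym.
  exact: product_measure_unique.
rewrite -integral12_prod_meas1; last first.
  apply: (@bounded_integrable _ _ _ _ h (M * M)) => //.
rewrite /fubini_F/=.
have Ef' : (\int[distribution P A']_x (f x)%:E = u%:E)%E.
  rewrite -Ef; apply: integral_distribution; first exact/measurable_EFinP.
  apply: (@bounded_integrable _ _ _ P (f \o A) M).
    exact: measurableT_comp.
  by move=> w; exact: fM.
have Eg' : (\int[distribution P B']_x (g x)%:E = v%:E)%E.
  rewrite -Eg; apply: integral_distribution; first exact/measurable_EFinP.
  apply: (@bounded_integrable _ _ _ P (g \o B) M).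
    exact: measurableT_comp.
  by move=> w; exact: gM.
under eq_integral => x _.
  under eq_integral => y _ do rewrite /h/= EFinM.
  rewrite integralZl//; last exact: (@bounded_integrable _ _ _ _ g M).
  rewrite [X in (_ * X)%E]Eg'.
  over.
rewrite integralZr//; last exact: (@bounded_integrable _ _ _ _ f M).
by rewrite [X in (X * _)%E]Ef' EFinM.
Qed.
Lemma independent2_comp A B f g : measurable_fun setT f ->
  measurable_fun setT g -> independent2 A B -> independent2 (f \o A) (g \o B).
Proof.
move=> mf mg AB U V mU mV; apply: (AB (f @^-1` U) (g @^-1` V)).
- by rewrite -[X in measurable X]setTI; exact: mf.
- by rewrite -[X in measurable X]setTI; exact: mg.
Qed.

Lemma independent2_cst A (c : R) : independent2 A (cst c).
Proof.
move=> U V mU mV; rewrite preimage_cst.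
case: ifPn => _; first by rewrite setIT probability_setT mule1.
by rewrite setI0 measure0 mule0.
Qed.

End Independence.

(** * Characteristic functions in polar form *)

Section CharacteristicFunction.
Context {R : realType} {d : measure_display} {T : measurableType d}.
Variable P : probability T R.
Implicit Types (A B : T -> R).

(** Keeping the factor [r] and the angle [phi] apart avoids complex integrals: adding independent
    variables multiplies the factors and adds the angles. *)
Definition has_cf A (r phi : R -> R) : Prop :=
  measurable_fun setT A /\ forall th,
    (\int[P]_w (cos (th * A w))%:E = (r th * cos (phi th))%:E)%E /\
    (\int[P]_w (sin (th * A w))%:E = (r th * sin (phi th))%:E)%E.

Lemma has_cf_cst c : has_cf (cst c) (cst 1) (fun th => th * c).
Proof.
have EP (v : R) : (\int[P]_w v%:E = v%:E)%E.
  have -> : (\int[P]_w v%:E = v%:E * P setT)%E by exact: integral_cst.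
  by rewrite probability_setT mule1.
by split=> // th; rewrite /cst !mul1r; split; exact: EP.
Qed.

Lemma has_cfZ A r phi c : has_cf A r phi ->
  has_cf (fun w => c * A w) (fun th => r (th * c)) (fun th => phi (th * c)).
Proof.
move=> [mA cfA]; split; first exact: measurable_funM.
move=> th; have [<- <-] := cfA (th * c).
by split; apply: eq_integral => w _; rewrite mulrA.
Qed.

Lemma has_cfD A B r phi r' phi' : independent2 P A B ->
  has_cf A r phi -> has_cf B r' phi' ->
  has_cf (fun w => A w + B w) (fun th => r th * r' th)
         (fun th => phi th + phi' th).
Proof.
move=> AB [mA cfA] [mB cfB]; split; first exact: measurable_funD.
move=> th; have [cA sA] := cfA th; have [cB sB] := cfB th.
have mcos : measurable_fun setT (fun x => cos (th * x) : R).
  apply: (@measurableT_comp _ _ _ _ _ _ cos _ ( *%R th)).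
    by apply: continuous_measurable_fun; exact: continuous_cos.
  exact: mulrl_measurable.
have msin : measurable_fun setT (fun x => sin (th * x) : R).
  apply: (@measurableT_comp _ _ _ _ _ _ sin _ ( *%R th)).
    by apply: continuous_measurable_fun; exact: continuous_sin.
  exact: mulrl_measurable.
(* [f] and [g] will range over the four choices of cosine and sine, whose products the addition
   formulas combine. *)
have E (f g : R -> R) (u v : R) :
    measurable_fun setT f -> measurable_fun setT g ->
    (forall x, `|f x| <= 1) -> (forall x, `|g x| <= 1) ->
    (\int[P]_w (f (A w))%:E = u%:E)%E -> (\int[P]_w (g (B w))%:E = v%:E)%E ->
    (\int[P]_w (f (A w) * g (B w))%:E = (u * v)%:E)%E /\
    P.-integrable setT (fun w => (f (A w) * g (B w))%:E).
  move=> mf mg f1 g1 Ef Eg; split.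
    exact: (@expectation_independent2 _ _ _ P A B f g u v 1).
  apply: (@bounded_integrable _ _ _ _ (fun w => f (A w) * g (B w)) 1).
    by apply: measurable_funM; exact: measurableT_comp.
  by move=> w; rewrite normrM mulr_ile1.
have cmax x : `|cos (th * x) : R| <= 1 by exact: cos_max.
have smax x : `|sin (th * x) : R| <= 1 by exact: sin_max.
have [ccE cci] := E _ _ _ _ mcos mcos cmax cmax cA cB.
have [ssE ssi] := E _ _ _ _ msin msin smax smax sA sB.
have [csE csi] := E _ _ _ _ mcos msin cmax smax cA sB.
have [scE sci] := E _ _ _ _ msin mcos smax cmax sA cB.
split.
- under eq_integral do rewrite mulrDr cosD EFinB.
  rewrite integralB//= ccE ssE -EFinB cosD; congr (_%:E); ring.
- under eq_integral do rewrite mulrDr sinD EFinD.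
  rewrite integralD//= csE scE -EFinD sinD; congr (_%:E); ring.
Qed.

End CharacteristicFunction.

(** * Stable characteristic functions of index other than 1 *)

Section Stable.
Context {R : realType}.
Variable al : R.
Implicit Types (V m be th c : R).

(* [V] stands for [si `^ al], the scale parameter that is additive under
   convolution. *)
Definition stable_amplitude V th : R := expR (- (V * `|th| `^ al)).

Definition stable_phase V be m th : R :=
  th * m + V * `|th| `^ al * be * Num.sg th * tan (pi * al / 2).

Lemma stable_amplitudeZ V c th : stable_amplitude V (th * c) =
  stable_amplitude (`|c| `^ al * V) th.
Proof.
by rewrite /stable_amplitude normrM powRM// [_ * `|c| `^ al]mulrC mulrCA mulrA.
Qed.

Lemma stable_amplitudeD V V' th :
  stable_amplitude V th * stable_amplitude V' th = stable_amplitude (V + V') th.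
Proof. by rewrite /stable_amplitude -expRD mulrDl opprD. Qed.

Lemma stable_phaseZ V be m c th : stable_phase V be m (th * c) =
  stable_phase (`|c| `^ al * V) (be * Num.sg c) (c * m) th.
Proof. by rewrite /stable_phase normrM powRM// sgrM; ring. Qed.

Lemma stable_phaseD V V' be m m' th :
  stable_phase V be m th + stable_phase V' be m' th =
  stable_phase (V + V') be (m + m') th.
Proof. by rewrite /stable_phase; ring. Qed.

Lemma cos_eq1_small (x : R) : `|x| < pi -> cos x = 1 -> x = 0.
Proof.
move=> xpi cx; apply/eqP; rewrite -normr_eq0; apply/eqP; apply: (@cos_inj R).
- by rewrite in_itv/= normr_ge0 ltW.
- by rewrite in_itv/= lexx pi_ge0.
- by rewrite cos_norm cos0.
Qed.

(* Compare [x = x0] with [x = x0 / 2]: [x] and [x `^ al] scale differently. *)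
Lemma powR_linear_eq0 (c e x0 : R) : 0 < al -> al != 1 -> 0 < x0 ->
  (forall x, 0 < x <= x0 -> x * c + x `^ al * e = 0) -> c = 0.
Proof.
move=> al0 al1 x00 h.
have h1 := h x0; rewrite x00 lexx/= in h1.
have {}h1 := h1 isT.
have h2 : x0 * 2^-1 * c + (x0 * 2^-1) `^ al * e = 0.
  by apply: h; rewrite mulr_gt0//= ler_piMr ?invf_le1 ?ler1n// ltW.
rewrite powRM ?ltW// in h2.
have half1 : 2^-1 `^ al != 2^-1 :> R.
  apply: contra al1 => /eqP /(congr1 (@ln R)).
  rewrite ln_powR => /eqP; rewrite -subr_eq0 -{2}[ln _]mul1r -mulrBl mulf_eq0.
  rewrite subr_eq0 => /orP[//|]; rewrite lt_eqF// ln_lt0//.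
  by rewrite invr_gt0 ltr0n/= invf_lt1 ?ltr1n.
(* Subtracting half the relation at [x0] from the one at [x0 / 2] eliminates [c]; the last factor is
   nonzero because [al != 1]. *)
have : x0 `^ al * e * (2^-1 `^ al - 2^-1) = 0.
  by rewrite -[RHS](subrr 0) -{1}h2 -[X in _ = _ - X](mulr0 2^-1) -h1; ring.
move/eqP; rewrite mulf_eq0 subr_eq0 (negbTE half1) orbF => /eqP e0.
move: h1; rewrite e0 addr0 => /eqP; rewrite mulf_eq0 gt_eqF//= => /eqP.
by [].
Qed.

Lemma stable_location_unique V be m V' be' m' : 0 < al -> al != 1 ->
  (forall th,
    stable_amplitude V th * cos (stable_phase V be m th) =
      stable_amplitude V' th * cos (stable_phase V' be' m' th) /\
    stable_amplitude V th * sin (stable_phase V be m th) =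
      stable_amplitude V' th * sin (stable_phase V' be' m' th)) ->
  m = m'.
Proof.
move=> al0 al1 h; apply/eqP; rewrite -subr_eq0; apply/eqP.
(* The phases agree modulo [2 pi], hence agree near [0], where both are small. *)
set c := m - m'.
set e := (V * be - V' * be') * tan (pi * al / 2).
have cos1 x : 0 < x -> cos (x * c + x `^ al * e) = 1.
  move=> x0; have [hc hs] := h x.
  have -> : x * c + x `^ al * e =
      stable_phase V be m x - stable_phase V' be' m' x.
    by rewrite /stable_phase gtr0_sg// gtr0_norm// /c /e; ring.
  move: hc hs; set f := stable_phase _ _ _ _; set f' := stable_phase _ _ _ _.
  have := expR_gt0 (- (V * `|x| `^ al)); have := expR_gt0 (- (V' * `|x| `^ al)).
  rewrite -/(stable_amplitude V x) -/(stable_amplitude V' x).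
  set r := stable_amplitude V x; set r' := stable_amplitude V' x.
  move=> r'0 r0 hc hs.
  (* Summing the squares of the cosine and sine equations removes the phases. *)
  have rr' : r = r'.
    apply/eqP; rewrite -(@eqrXn2 _ 2%N)// ?ltW//.
    rewrite -[r ^+ 2]mulr1 -(cos2Dsin2 f) -[r' ^+ 2]mulr1 -(cos2Dsin2 f').
    by rewrite !mulrDr -!exprMn hc hs.
  rewrite -rr' in hc hs.
  have r_neq0 : r != 0 by rewrite gt_eqF.
  move/(mulfI r_neq0) : hc => hc; move/(mulfI r_neq0) : hs => hs.
  by rewrite cosB hc hs -!expr2 cos2Dsin2.
(* Up to [x0], each of the two terms of the phase difference is below 1 in absolute value, so the
   difference stays below [2 <= pi], where the cosine equals 1 only at 0. *)
pose x0 := Num.min (`|c| + 1)^-1 ((`|e| + 1)^-1 `^ al^-1).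
have c1 : 0 < `|c| + 1 by rewrite ltr_wpDl.
have e1 : 0 < `|e| + 1 by rewrite ltr_wpDl.
have x00 : 0 < x0 by rewrite lt_min invr_gt0 c1 powR_gt0// invr_gt0.
apply: (@powR_linear_eq0 c e x0) => // x /andP[xpos].
rewrite le_min => /andP[xc xe]; apply: cos_eq1_small; last exact: cos1.
have xe' : x `^ al <= (`|e| + 1)^-1.
  apply: (@le_trans _ _ (((`|e| + 1)^-1 `^ al^-1) `^ al)).
    by apply: ge0_ler_powR; rewrite ?nnegrE ?powR_ge0// ltW.
  by rewrite -powRrM mulVf ?gt_eqF// powRr1// invr_ge0 ltW.
have lt1 (y z : R) : 0 < z -> z <= (`|y| + 1)^-1 -> `|z * y| < 1.
  move=> z0 zy; rewrite normrM (gtr0_norm z0).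
  have y1 : 0 < `|y| + 1 by rewrite ltr_wpDl.
  rewrite -lef_pV2 ?posrE ?invr_gt0// invrK in zy.
  rewrite -ltr_pdivlMl// mulr1 (lt_le_trans _ zy)//.
  by rewrite ltrDl.
apply: (le_lt_trans (ler_normD _ _)); apply: lt_le_trans (pi_ge2 R).
by rewrite -[2]/(1 + 1) ltrD// lt1// powR_gt0.
Qed.

Lemma stable_lawE (d : measure_display) (T : measurableType d)
    (P : probability T R) (Z : T -> R) be (si : R) m : al != 1 ->
  stable_law P Z al be si m <->
  has_cf P Z (stable_amplitude (`|si| `^ al))
    (stable_phase (`|si| `^ al) be m).
Proof.
move=> al1; rewrite /stable_law /has_cf /stable_amplitude /stable_phase.
rewrite /stable_arg al1; split=> -[mZ h]; split=> // th; have := h th;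
  by rewrite normrM powRM.
Qed.

End Stable.

(** * Independence of the earlier increments *)

Section IndependentOfPast.
Context {R : realType} {d : measure_display} {T : measurableType d}.
Variables (P : probability T R) (Y : nat -> T -> R).

Definition past (B : nat -> set R) (j : nat) : set T :=
  \bigcap_(i in `I_j) (Y i @^-1` B i).

(** The invariant of the backward recursion: [log Z_j] is built from the increments of index at
    least [j], and must be independent of all the earlier ones jointly, since these enter one at a
    time in later steps. *)
Definition independent_of_past (A : T -> R) (j : nat) : Prop :=
  forall U (B : nat -> set R), measurable U -> (forall i, measurable (B i)) ->
    P (A @^-1` U `&` past B j) = (P (A @^-1` U) * P (past B j))%E.

Lemma pastS B j : past B j.+1 = Y j @^-1` B j `&` past B j.
Proof.
apply/seteqP; split => [w h|w [hj h] i /= ij].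
  by split; [apply: h => /=|move=> i /= ij; apply: h => /=; exact: ltnW].
have [->|ij'] := eqVneq i j; first exact: hj.
by apply: h => /=; rewrite ltn_neqAle ij' -ltnS.
Qed.

Lemma measurable_past B j : (forall i, measurable_fun setT (Y i)) ->
  (forall i, measurable (B i)) -> measurable (past B j).
Proof.
move=> mY mB; apply: bigcap_measurableType => i _.
by rewrite -[X in measurable X]setTI; exact: mY.
Qed.

(** Applying both hypotheses in turn factors the probability over [A], [Y j] and the past. A trivial
    past gives the independence of [A] and [Y j]; the factorisation on rectangles then extends to
    preimages under [f]. *)
Lemma independent_of_past_comp A (f : R * R -> R) j :
  (forall i, measurable_fun setT (Y i)) -> measurable_fun setT A ->
  measurable_fun setT f ->
  independent_of_past (Y j) j -> independent_of_past A j.+1 ->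
  independent2 P A (Y j) /\ independent_of_past (fun w => f (A w, Y j w)) j.
Proof.
move=> mY mA mf Yj Aj.
have AYE (U V : set R) (B : nat -> set R) : measurable U -> measurable V ->
    (forall i, measurable (B i)) ->
    P (A @^-1` U `&` (Y j @^-1` V `&` past B j)) =
    (P (A @^-1` U) * (P (Y j @^-1` V) * P (past B j)))%E.
  (* Placing [V] at index [j] makes the event for [Y j] part of a past of length [j.+1]. *)
  move=> mU mV mB; pose B' i := if i == j then V else B i.
  have mB' i : measurable (B' i) by rewrite /B'; case: ifP.
  have -> : Y j @^-1` V `&` past B j = past B' j.+1.
    rewrite pastS /B' eqxx; congr (_ `&` _); apply: eq_bigcapr => i /= ij.
    by rewrite ltn_eqF.
  rewrite Aj// pastS /B' eqxx; congr (_ * _)%E.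
  have -> : past (fun i => if i == j then V else B i) j = past B j.
    by apply: eq_bigcapr => i /= ij; rewrite ltn_eqF.
  exact: Yj.
have AY : independent2 P A (Y j).
  move=> U V mU mV.
  have := AYE U V (fun=> setT) mU mV (fun=> measurableT).
  have -> : past (fun=> setT) j = setT by apply/seteqP; split.
  by rewrite setIT probability_setT mule1.
split=> // U B mU mB.
apply: (@independent2_pair _ _ _ P A (Y j) (past B j) (f @^-1` U)) => //.
- exact: measurable_past.
- by move=> U' V' mU' mV'; exact: AYE.
- by rewrite -[X in measurable X]setTI; exact: mf.
Qed.

Lemma mutually_independent_of_past j : (forall i, measurable_fun setT (Y i)) ->
  (forall n, mutually_independent P (fun i : 'I_n => Y i)) ->
  independent_of_past (Y j) j.
Proof.
move=> mY indY U B mU mB.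
have pastE n (C : nat -> set R) : (forall i, measurable (C i)) ->
    P (past C n) = (\prod_(i < n) P (Y i @^-1` C i))%E.
  move=> mC; have [_ <-//] := indY n; congr (P _).
  apply/seteqP; split => w h i; first by move=> _; apply: h => /=.
  by move=> ilt; have := h (Ordinal ilt) I.
pose C i := if i == j then U else B i.
have mC i : measurable (C i) by rewrite /C; case: ifP.
have -> : Y j @^-1` U `&` past B j = past C j.+1.
  rewrite pastS /C eqxx; congr (_ `&` _); apply: eq_bigcapr => i /= ij.
  by rewrite ltn_eqF.
rewrite !pastE// big_ord_recr/= /C eqxx muleC; congr (_ * _)%E.
by apply: eq_bigr => i _; rewrite ltn_eqF.
Qed.

End IndependentOfPast.

(** AM-GM at the value of [Z] with index [j.+1] bounds one step, and the induction hypothesis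
    replaces that value by the one of [W]. Positivity is carried along because AM-GM asks for it. *)
Lemma Zaux_le_Waux (R : realType) (Xj w a : nat -> R) k n j :
  (forall i, 0 < Xj i) -> (forall i, 0 < w i) ->
  (forall i, (j < i <= n + j)%N -> 0 < a i) ->
  0 < Zaux Xj w k a n j <= Waux Xj w k n j.
Proof.
move=> X0 w0; elim: n j => [|n IHn] j a0 /=; first by rewrite lexx divr_gt0.
have aj : 0 < a j.+1 by apply: a0; rewrite ltnS leqnn addSn ltnS leq_addl.
have {IHn} /andP[Z0 ZW] : 0 < Zaux Xj w k a n j.+1 <= Waux Xj w k n j.+1.
  by apply: IHn => i /andP[ji ij]; apply: a0; rewrite (ltnW ji) addSnnS.
have aw : 0 < a j.+1 + w j.+1 by rewrite addr_gt0.
rewrite mulr_gt0 ?powR_gt0 ?divr_gt0//= mulrAC ler_pM2r ?invr_gt0//.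
by rewrite (le_trans (weighted_amgm _ _ _ _ aj (w0 _) Z0))// lerD2r.
Qed.

(** * Geometric sums and the recursion for the scale *)

Section GeometricSum.
Context {R : realType}.
Variables (q al : R).
Hypothesis q0 : 0 < q.

Definition geom (n : nat) : R := \sum_(i < n) q ^+ i.

Lemma geomS n : geom n.+1 = 1 + q * geom n.
Proof.
rewrite /geom big_ord_recl expr0 mulr_sumr; congr (_ + _).
by apply: eq_bigr => i _; rewrite exprS.
Qed.

Lemma geom_ge0 n : 0 <= geom n.
Proof. by apply: sumr_ge0 => i _; rewrite exprn_ge0// ltW. Qed.

Lemma geom_gt0 n : 0 < geom n.+1.
Proof. by rewrite geomS ltr_pwDl// mulr_ge0 ?geom_ge0// ltW. Qed.

Lemma le_geom i n : (i <= n)%N -> geom i <= geom n.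
Proof.
move=> /subnK <-; elim: (n - i)%N => // {}n IHn; rewrite (le_trans IHn)//.
by rewrite addSn /geom big_ord_recr/= lerDl exprn_ge0// ltW.
Qed.

Lemma geomE i n : q != 1 -> geom i / geom n = (q ^+ i - 1) / (q ^+ n - 1).
Proof.
move=> q1; rewrite !subrX1 -/(geom i) -/(geom n) invfM mulrACA divff ?mul1r//.
by rewrite subr_eq0.
Qed.

(** With [q = expR (- mu)], this is the factor by which the [al]-th power of the scale of
    [log Z_{k-n}] exceeds that of [si]; at [n = k], [geomE] turns it into the sum of the theorem. *)
Definition scale_sum (n : nat) : R :=
  1 + \sum_(1 <= i < n) (1 - geom i / geom n) `^ al.

Lemma scale_sum_gt0 n : 0 < scale_sum n.
Proof. by rewrite ltr_pwDl// sumr_ge0// => i _; rewrite powR_ge0. Qed.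

(** The base of the power is the weight [b] of one recursion step and equals [1 - 1 / geom n.+2], so
    its power is the summand [i = 1] on the left. The others shift by one: [b * (1 - geom i / geom
    n.+1) = 1 - geom i.+1 / geom n.+2]. *)
Lemma scale_sumS n : scale_sum n.+2 =
  1 + (q * geom n.+1 / geom n.+2) `^ al * scale_sum n.+1.
Proof.
have g1 := geom_gt0 n; have g2 := geom_gt0 n.+1.
rewrite /scale_sum big_ltn// big_add1/=; congr (_ + _).
rewrite mulrDr mulr1; congr (_ + _).
  congr (_ `^ _); rewrite {1}/geom big_ord1 expr0 (geomS n.+1).
  by field; rewrite -geomS gt_eqF.
rewrite mulr_sumr; apply: eq_big_nat => i /andP[i1 ilt].
rewrite -powRM; last 2 first.
- by rewrite divr_ge0 ?mulr_ge0 ?ltW.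
- by rewrite subr_ge0 ler_pdivrMr// mul1r le_geom// ltnW.
congr (_ `^ _); rewrite (geomS i).
have -> : 1 - (1 + q * geom i) / geom n.+2 =
    (geom n.+2 - (1 + q * geom i)) / geom n.+2 by field; rewrite gt_eqF.
by rewrite (geomS n.+1); field; rewrite -geomS !gt_eqF.
Qed.

End GeometricSum.

(** * Propagation of the law along the recursion, and conclusion *)

Lemma stable_cf_step (R : realType) (d : measure_display)
    (T : measurableType d) (P : probability T R) (A B : T -> R)
    (al be V V' m m' b c : R) :
  0 < b -> independent2 P A B ->
  has_cf P A (stable_amplitude al V) (stable_phase al V (- be) m) ->
  has_cf P B (stable_amplitude al V') (stable_phase al V' be m') ->
  has_cf P (fun w => (b * A w + (-1) * B w) + c)
    (stable_amplitude al (V' + b `^ al * V))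
    (stable_phase al (V' + b `^ al * V) (- be) (b * m - m' + c)).
Proof.
move=> b0 AB cfA cfB.
have AB' : independent2 P (fun w => b * A w) (fun w => -1 * B w).
  by apply: (independent2_comp P A B ( *%R b) ( *%R (-1))) => //;
    exact: mulrl_measurable.
(* Negating [B] turns its skewness [be] into [- be], that of [A], so the two phases add within one
   stable family; the constant [c] only shifts the location. *)
have := has_cfD _ _ _ _ _ _ _ (independent2_cst P _ c)
  (has_cfD _ _ _ _ _ _ _ AB' (has_cfZ _ _ _ _ b cfA)
    (has_cfZ _ _ _ _ (-1) cfB)) (has_cf_cst P c).
congr (has_cf _ _ _ _); apply/funext => th /=.
  by rewrite !stable_amplitudeZ stable_amplitudeD normrN1 powR1 mul1r mulr1
    gtr0_norm// addrC.
rewrite !stable_phaseZ normrN1 powR1 mul1r sgrN1 mulrN1 mulN1r gtr0_sg// mulr1.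
by rewrite gtr0_norm// stable_phaseD /stable_phase; ring.
Qed.

Theorem theorem5 (R : realType) (d : measure_display) (T : measurableType d)
  (P : probability T R) (X : R -> T -> R)
  (al be si mu : R) (k : nat) (a : nat -> R) :
  (* parameters *)
  0 < al -> al <= 2 -> -1 <= be -> be <= 1 -> 0 < si ->
  (* wealth process: positive, log X has cadlag paths, independent increments
     and stable increments *)
  (forall t, 0 <= t -> forall w, 0 < X t w) ->
  (forall t, 0 <= t -> measurable_fun setT (X t)) ->
  (forall w t, 0 <= t ->
     (fun u => ln (X u w)) x @[x --> t^'+] --> ln (X t w)) ->
  (forall w t, 0 < t -> cvg ((fun u => ln (X u w)) x @[x --> t^'-])) ->
  (forall (n : nat) (s : nat -> R), 0 <= s 0%N ->
     (forall i, (i < n)%N -> s i < s i.+1) ->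
     mutually_independent P
       (fun (i : 'I_n) w => ln (X (s i.+1) w) - ln (X (s i) w))) ->
  (forall s t, 0 <= s -> s < t ->
     stable_law P (fun w => ln (X t w / X s w))
       al be (si * (t - s) `^ (al^-1)) (mu * (t - s))) ->
  (* assumptions of the theorem *)
  al != 1 -> mu != 0 -> (1 <= k)%N ->
  (* a_j = exp(mu_j), mu_j the location parameter of log Z_j^* *)
  (let Xj := fun (w : T) (j : nat) => X j%:R w / X j.-1%:R w in
   let Z := fun (j : nat) (w : T) => Zstar (Xj w) (fun=> 1) k a j in
   (forall j, (1 <= j < k)%N ->
      exists b s m, stable_law P (fun w => ln (Z j w)) al b s m /\
                    a j = expR m) ->
   {ae P, forall w, Z 0%N w <= Pstar (Xj w) (fun=> 1) k} /\
   exists si0, 0 < si0 /\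
     si0 `^ al = si `^ al *
       (1 + \sum_(1 <= j < k)
              (1 - (expR (- mu * j%:R) - 1) / (expR (- mu * k%:R) - 1)) `^ al) /\
     stable_law P (fun w => ln (Z 0%N w)) al (- be) si0
       (- mu + ln ((expR (- mu * k%:R) - 1) / (expR (- mu) - 1)))).
Proof.
move=> al0 al2 _ _ si0 X0 mX _ _ indX stX al1 mu0 k1 Xj Z hZ.
(* Indices start at 0: [Y j] is [log X_{j+1}], the increment used in passing from [Z_{j+1}] to
   [Z_j]. *)
pose Y (i : nat) (w : T) := ln (X i.+1%:R w) - ln (X i%:R w).
pose q := expR (- mu).
pose g := geom q.
pose V n := si `^ al * scale_sum q al n.
have q0 : 0 < q by exact: expR_gt0.
have q1 : q != 1 by rewrite -expR0 (inj_eq (@expR_inj R)) oppr_eq0.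
have lnXj w j : ln (Xj w j.+1) = Y j w.
  by rewrite /Xj/= ln_div ?posrE ?X0.
have Xj0 w j : 0 < Xj w j by rewrite /Xj divr_gt0 ?X0.
have mY i : measurable_fun setT (Y i).
  by apply: measurable_funB; (apply: measurableT_comp;
    [exact: measurable_ln|exact: mX]).
have indY n : mutually_independent P (fun i : 'I_n => Y i).
  have := indX n (fun i => i%:R) (ler0n _ _); apply => i _.
  by rewrite ltr_nat.
have past_indY j : independent_of_past P Y (Y j) j.
  exact: mutually_independent_of_past.
have cfY j : has_cf P (Y j) (stable_amplitude al (si `^ al))
    (stable_phase al (si `^ al) be mu).
  have := stX j%:R j.+1%:R (ler0n _ _); rewrite ltr_nat ltnSn => /(_ isT).
  have -> : j.+1%:R - j%:R = 1 :> R by rewrite -natr1 addrAC subrr add0r.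
  rewrite powR1 !mulr1 stable_lawE// gtr0_norm//.
  by under eq_fun do rewrite -[X in ln X]/(Xj _ j.+1) lnXj.
have a0 j : (1 <= j < k)%N -> 0 < a j.
  by move=> /hZ [b [s [m [_ ->]]]]; exact: expR_gt0.
have ZW w n j : (n + j).+1 = k ->
    0 < Zaux (Xj w) (fun=> 1) k a n j <= Waux (Xj w) (fun=> 1) k n j.
  move=> njk; apply: Zaux_le_Waux => // i /andP[ji ij]; apply: a0.
  by rewrite (leq_ltn_trans _ ji)//= -njk ltnS.
pose L n j w := ln (Zaux (Xj w) (fun=> 1) k a n j).
(* Induction on the number [n] of steps back from [Z_{k-1}]; the independence is carried along with
   the law because the next step needs it. *)
have LP n j : (n + j).+1 = k -> independent_of_past P Y (L n j) j /\
    has_cf P (L n j) (stable_amplitude al (V n.+1))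
      (stable_phase al (V n.+1) (- be) (- mu + ln (g n.+1))).
  elim: n j => [|n IHn] j njk.
    have LE : L 0%N j = fun w => -1 * Y j w.
      apply/funext => w; rewrite /L/= -njk add0n -lnXj mulN1r div1r lnV//.
      by rewrite posrE.
    split.
      rewrite LE => U B mU mB; apply: (past_indY j (( *%R (-1)) @^-1` U)) => //.
      by rewrite -[X in measurable X]setTI; exact: mulrl_measurable.
    have := has_cfZ P _ _ _ (-1) (cfY j); rewrite -LE.
    congr (has_cf _ _ _ _); apply/funext => th.
      rewrite stable_amplitudeZ normrN1 powR1 mul1r /V /scale_sum.
      by rewrite big_geq// addr0 mulr1.
    rewrite stable_phaseZ normrN1 powR1 mul1r /V /scale_sum.
    rewrite big_geq// addr0 mulr1 sgrN1 mulrN1 mulN1r.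
    by rewrite /g /geom big_ord1 expr0 ln1 addr0.
  have njk' : (n + j.+1).+1 = k by rewrite addnS -addSn.
  have [Lind Lcf] := IHn _ njk'.
  have jk : (1 <= j.+1 < k)%N by rewrite /= -njk' ltnS leq_addl.
  have [be' [s [m [Zst am]]]] := hZ _ jk.
  have gn0 : 0 < g n.+1 by exact: geom_gt0.
  (* The hypothesis provides some parameters fitting the law; uniqueness of the location identifies
     [m] with the one from the induction. *)
  have mE : m = - mu + ln (g n.+1).
    have : stable_law P (L n j.+1) al be' s m.
      move: Zst; rewrite /Z /Zstar /L.
      by have -> : (k.-1 - j.+1)%N = n by rewrite -njk' /= addnK.
    rewrite stable_lawE// => -[_ cf1]; have [_ cf2] := Lcf.
    apply: (stable_location_unique al) => // th.
    have [c1 s1] := cf1 th; have [c2 s2] := cf2 th.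
    by split; apply: EFin_inj; [exact: etrans (esym c1) c2|
      exact: etrans (esym s1) s2].
  (* Adding the withdrawal 1 to this value produces the next geometric sum, so [b] becomes a ratio
     of such sums. *)
  have aE : a j.+1 = q * g n.+1 by rewrite am mE expRD lnK.
  have aj0 := a0 _ jk.
  have a1E : a j.+1 + 1 = g n.+2 by rewrite addrC aE /g [in RHS]geomS.
  have gn1 : 0 < g n.+2 by exact: geom_gt0.
  pose b := a j.+1 / (a j.+1 + 1).
  have b0 : 0 < b by rewrite divr_gt0// a1E.
  (* The deterministic part of the logarithm of one step: [ln (a j.+1 + 1)] minus [b] times
     [ln (a j.+1) = m]. *)
  pose c := ln (g n.+2) - b * m.
  have LE : L n.+1 j = fun w => (b * L n j.+1 w + (-1) * Y j w) + c.
    apply/funext => w; rewrite /L/= -lnXj.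
    have /andP[Z0 _] := ZW w _ _ njk'.
    have := Xj0 w j.+1; move: (Xj w j.+1) => x x0.
    rewrite lnM ?posrE ?powR_gt0 ?divr_gt0// ?a1E// ln_div ?posrE//.
    rewrite ln_powR ln_div ?posrE//.
    by rewrite -a1E -/b /c -a1E {2}am expRK; ring.
  have mL : measurable_fun setT (L n j.+1) by have [] := Lcf.
  pose f (z : R * R) : R := (b * z.1 + (-1) * z.2) + c.
  have mf : measurable_fun setT f.
    by apply: measurable_funD => //; apply: measurable_funD;
      apply: measurable_funM.
  have [LY Lpast] := independent_of_past_comp P Y _ f _ mY mL mf
    (past_indY j) Lind.
  rewrite LE; split; first exact: Lpast.
  have := stable_cf_step _ _ _ _ _ _ al be _ _ _ _ b c b0 LY Lcf (cfY j).
  have -> : si `^ al + b `^ al * V n.+1 = V n.+2.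
    by rewrite /V (scale_sumS _ _ q0) /b a1E aE /g; ring.
  (* The term [- b * m] in [c] cancels the scaled location: this is the effect of choosing
     [a_j = exp m_j]. *)
  have -> // : b * (- mu + ln (g n.+1)) - mu + c = - mu + ln (g n.+2).
  by rewrite /c mE; ring.
have k1k : (k.-1 + 0).+1 = k by rewrite addn0 prednK.
split.
  apply: aeW => w; rewrite /Z /Zstar /Pstar /Wstar subn0.
  by have /andP[] := ZW w _ _ k1k.
have Vk0 : 0 < V k by rewrite mulr_gt0 ?powR_gt0// scale_sum_gt0.
have expRX j : expR (- mu * j%:R) = q ^+ j by rewrite expRM_natr.
exists (V k `^ al^-1); split; first exact: powR_gt0.
have VkE : (V k `^ al^-1) `^ al = V k.
  by rewrite -powRrM mulVf ?gt_eqF// powRr1// ltW.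
split.
  rewrite VkE /V /scale_sum; congr (_ * (_ + _)).
  by apply: eq_bigr => j _; rewrite !expRX geomE.
rewrite stable_lawE// gtr0_norm ?powR_gt0// VkE.
have [_] := LP _ _ k1k; rewrite prednK// /L.
(* The closed form divides by [q - 1], nonzero because [mu != 0]. *)
have -> : g k = (expR (- mu * k%:R) - 1) / (expR (- mu) - 1).
  by rewrite expRX subrX1 -/(geom q k) -/q mulrAC divff ?mul1r// subr_eq0.
by rewrite /Z /Zstar subn0.
Qed.
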